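(* Let $X\subset\mathbb{R}^n$ be a convex closed set and let $f\in\mathbb{R}[x_1,\ldots,x_n]$ be a polynomial of degree $d$ with leading form $f_d$. Assume that $f$ is positive on $X$, that $f_d^{-1}(0)=\{0\}$, and that there exists $m\in\mathbb{R}$ such that $$0<m\le\inf\{f(x):x\in X\}.$$ Then there exists $N_0\in\mathbb{N}$ such that for any integer $N\ge N_0$ the polynomial $\varphi_N(x)=(1+x_1^2+\cdots+x_n^2)^Nf(x)$ is strongly convex on $X$.
   Context: The leading form $f_d$ of a polynomial $f$ of degree $d$ is its homogeneous component of degree $d$ (so $f_d\neq 0$). A function $\varphi$ is strongly convex on a convex set $X$ if there is $\mu>0$ such that $\varphi(x)-\frac{\mu}{2}|x|^2$ is convex on $X$. *)

(* Defs.v *)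
(* MathComp with MathComp-Analysis and multinomials.  Only the canonical
   structures and coercions of mpoly are imported, and its names are used
   qualified: its notations and short names clash with MathComp-Analysis. *)
From HB Require Import structures.
From mathcomp Require Import all_boot all_order all_algebra.
From mathcomp Require Import (canonicals, coercions) mpoly.
From mathcomp Require Import all_classical all_reals all_analysis.

Set Implicit Arguments.
Unset Strict Implicit.
Unset Printing Implicit Defensive.

Import Order.TTheory GRing.Theory Num.Theory.
Import numFieldNormedType.Exports.

Local Open Scope classical_set_scope.
Local Open Scope ring_scope.

Definition peval (R : realType) (n : nat) (f : mpoly.mpoly n R)
    (x : 'rV[R]_n) : R :=
  mpoly.meval (x ord0) f.

(* mpoly.msize is one more than the total degree, and 0 for the zero
   polynomial, so the zero polynomial has no degree. *)
Definition has_degree (R : realType) (n : nat) (f : mpoly.mpoly n R)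
    (d : nat) : Prop :=
  mpoly.msize f = d.+1.

(* This is the leading form of f when has_degree f d. *)
Definition leading_form (R : realType) (n : nat) (f : mpoly.mpoly n R)
    (d : nat) : mpoly.mpoly n R :=
  mpoly.pihomog mpoly.mdeg d f.

(* The square of the Euclidean norm; the library norm on 'rV[R]_n is the
   sup norm. *)
Definition sqnorm (R : realType) (n : nat) (x : 'rV[R]_n) : R :=
  \sum_(i < n) x ord0 i ^+ 2.

Definition strongly_convex (R : realType) (n : nat) (X : set 'rV[R]_n)
    (phi : 'rV[R]_n -> R) : Prop :=
  exists mu : R, 0 < mu /\
    convex_function (E := 'rV[R]_n) X (fun x => phi x - mu / 2 * sqnorm x).

(* mpoly.mpolyX R (mpoly.mnm1 i) is the i-th variable. *)
Definition phi_poly (R : realType) (n : nat) (f : mpoly.mpoly n R)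
    (N : nat) : mpoly.mpoly n R :=
  (1 + \sum_(i < n) mpoly.mpolyX R (mpoly.mnm1 i) ^+ 2) ^+ N * f.

(* Main.v *)
(* Write g = 1 + |x|^2.  Along a line with direction v, with s = <x, v>, the
   second derivative of g^N f is
     g^(N-2) (4 N (N-1) s^2 f + 2 N g |v|^2 f + 4 N g s f_v + g^2 f_vv).
   Since f_d does not vanish on the unit sphere, |f_d(x)| >= e |x|^d, so
   f >= c (1 + |x|)^d on X: for large |x| because f_d dominates the lower order
   terms, for bounded x because f >= m.  As the derivatives of f have lower
   degree, g f_v^2 <= K |v|^2 f^2 and g |f_vv| <= K |v|^2 f on X.  The cross
   term is then absorbed by the first two terms, and the second derivative is
   at least m |v|^2 once 2 N >= 3 K + 1. *)
Require Import Defs.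
From HB Require Import structures.
From mathcomp Require Import all_boot all_order all_algebra.
From mathcomp Require Import (canonicals, coercions) mpoly.
From mathcomp Require Import all_classical all_reals all_analysis.
From mathcomp Require Import ring lra.
From mathcomp Require polyrcf.

Set Implicit Arguments.
Unset Strict Implicit.
Unset Printing Implicit Defensive.

Import Order.TTheory GRing.Theory Num.Theory.
Import numFieldNormedType.Exports.

Local Open Scope classical_set_scope.
Local Open Scope ring_scope.

(** * Restriction of a polynomial to a line *)

Section LineRestriction.
Context {R : realType} {n : nat}.
Implicit Types (f : mpoly.mpoly n R) (x v : 'rV[R]_n) (t : R).

Definition line_coord x v (i : 'I_n) : {poly R} :=
  (x ord0 i)%:P + v ord0 i *: 'X.

(** The restriction is kept as an element of [{poly R}], so that its derivatives are formal and
    convexity reduces to real algebra in one variable. *)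
Definition line_poly x v f : {poly R} := mpoly.mmap polyC (line_coord x v) f.

Lemma horner_line_coord x v i t :
  (line_coord x v i).[t] = (x + t *: v) ord0 i.
Proof. by rewrite !hornerE !mxE mulrC. Qed.

Lemma deriv_line_coord x v i : (line_coord x v i)^`() = (v ord0 i)%:P.
Proof. by rewrite derivD derivC add0r derivZ derivX alg_polyC. Qed.

Lemma horner_line_poly x v f t :
  (line_poly x v f).[t] = peval f (x + t *: v).
Proof.
rewrite /line_poly /peval mpoly.mevalE /mpoly.mmap horner_sum.
apply: eq_bigr => m _; rewrite hornerM hornerC /mpoly.mmap1 horner_prod.
congr (_ * _); apply: eq_bigr => i _.
by rewrite horner_exp horner_line_coord.
Qed.

Lemma line_polyM x v : {morph line_poly x v : f g / f * g}.
Proof. by move=> f g; rewrite /line_poly rmorphM. Qed.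

Lemma line_polyX x v i :
  line_poly x v (mpoly.mpolyX R (mpoly.mnm1 i)) = line_coord x v i.
Proof. by rewrite /line_poly mpoly.mmapX mpoly.mmap1U. Qed.

(** This is the chain rule. The polynomials that satisfy it include the constants and the variables
    and are closed under sums and, by the Leibniz rule on both sides, under products; hence they are
    all polynomials. *)
Lemma deriv_line_poly x v f :
  (line_poly x v f)^`() =
  \sum_i v ord0 i *: line_poly x v (mpoly.mderiv i f).
Proof.
pose P f := (line_poly x v f)^`() =
  \sum_i v ord0 i *: line_poly x v (mpoly.mderiv i f).
have P0 c : P (mpoly.mpolyC n c).
  rewrite /P /line_poly mpoly.mmapC derivC big1 // => i _.
  by rewrite mpoly.mderivC mpoly.mmap0 scaler0.
have PD g h : P g -> P h -> P (g + h).
  rewrite /P /line_poly => Pg Ph.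
  rewrite mpoly.mmapD derivD Pg Ph -big_split; apply: eq_bigr => i _.
  by rewrite mpoly.mderivD mpoly.mmapD scalerDr.
have PM g h : P g -> P h -> P (g * h).
  rewrite /P => Pg Ph.
  rewrite line_polyM derivM Pg Ph mulr_suml mulr_sumr -big_split.
  apply: eq_bigr => i _ /=.
  rewrite mpoly.mderivM /line_poly mpoly.mmapD -!/(line_poly _ _ _).
  by rewrite !line_polyM scalerDr scalerAl scalerAr.
have PX j : P (mpoly.mpolyX R (mpoly.mnm1 j)).
  rewrite /P line_polyX deriv_line_coord (bigD1 j) //= big1 => [|i ij].
    rewrite mpoly.mderivX mpoly.mnm1E eqxx scale1r addr0.
    rewrite (_ : mpoly.mnm_sub _ _ = mpoly.mnm0); last first.
      by apply/mpoly.mnmP => i; rewrite mpoly.mnmBE mpoly.mnm0E subnn.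
    by rewrite mpoly.mpolyX0 /line_poly rmorph1 -alg_polyC.
  rewrite mpoly.mderivX mpoly.mnm1E eq_sym (negPf ij) scale0r.
  by rewrite /line_poly mpoly.mmap0 scaler0.
apply: (mpoly.mpolyind (P := P)) => [|c m p _ _ Pp].
  by rewrite -(mpoly.mpolyC0 n R).
apply: (PD) => //; rewrite -mpoly.mul_mpolyC; apply: (PM) => //.
rewrite mpoly.mpolyXE_id.
apply: (big_ind P) => [||i _]; [exact: (P0 1)|exact: PM|].
elim: (m i) => [|k IH]; first exact: (P0 1).
by rewrite exprS; apply: PM.
Qed.

Lemma horner_deriv_line_poly x v f t :
  (line_poly x v f)^`().[t] =
  \sum_i v ord0 i * peval (mpoly.mderiv i f) (x + t *: v).
Proof.
rewrite deriv_line_poly horner_sum; apply: eq_bigr => i _.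
by rewrite hornerZ horner_line_poly.
Qed.

Lemma horner_deriv2_line_poly x v f t :
  (line_poly x v f)^`()^`().[t] =
  \sum_i v ord0 i * \sum_j v ord0 j *
    peval (mpoly.mderiv j (mpoly.mderiv i f)) (x + t *: v).
Proof.
rewrite deriv_line_poly raddf_sum horner_sum; apply: eq_bigr => i _ /=.
by rewrite derivZ hornerZ horner_deriv_line_poly.
Qed.

End LineRestriction.

(** * Convexity and second derivatives in one variable *)

Lemma horner_convex (R : realType) (p : {poly R}) (t : R) :
  (forall s, 0 <= s <= 1 -> 0 <= p^`()^`().[s]) -> 0 <= t <= 1 ->
  p.[t] <= t * p.[1] + (1 - t) * p.[0].
Proof.
move=> p2 /andP[]; rewrite le_eqVlt => /predU1P[<- _|t0].
  by rewrite mul0r add0r subr0 mul1r.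
rewrite le_eqVlt => /predU1P[->|t1]; first by rewrite subrr mul0r addr0 mul1r.
have [a aI ea] := polyrcf.poly_mvt p t0.
have [b bI eb] := polyrcf.poly_mvt p t1.
have : p^`().[a] <= p^`().[b].
  apply: (polyrcf.ler_hornerW (a := 0) (b := 1)) => [s sI||| ].
  - by apply: p2; rewrite !(itvP sI).
  - by rewrite in_itv /= (itvP aI) (le_trans _ (ltW t1)) // (itvP aI).
  - by rewrite in_itv /= (itvP bI) (le_trans (ltW t0)) // (itvP bI).
  - by rewrite (@le_trans _ _ t) // ?(itvP aI) ?(itvP bI).
rewrite -subr_ge0 => ab.
have t1' : 0 <= 1 - t by rewrite subr_ge0 ltW.
have := mulr_ge0 (mulr_ge0 (ltW t0) t1') ab; rewrite -[in X in _ -> X]subr_ge0.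
rewrite (_ : _ * (p^`().[b] - _) = t * (p^`().[b] * (1 - t)) -
  (1 - t) * (p^`().[a] * (t - 0))); last ring.
by rewrite -ea -eb; congr (0 <= _); ring.
Qed.

Lemma deriv2_expM (R : comNzRingType) (g p : {poly R}) (k : nat) :
  (g ^+ k.+2 * p)^`()^`() =
  g ^+ k * ((k.+2 * k.+1)%:R%:P * g^`() ^+ 2 * p
    + k.+2%:R%:P * g * g^`()^`() * p + (2 * k.+2%:R)%:P * g * g^`() * p^`()
    + g ^+ 2 * p^`()^`()).
Proof.
rewrite [(2 * _)%:P]polyCM !polyC_natr.
have dexp n : (g ^+ n.+1)^`() = n.+1%:R * (g ^+ n * g^`()).
  by rewrite deriv_exp mulr_natl mulrC.
have dnat n (h : {poly R}) : (n%:R * h)^`() = n%:R * h^`().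
  by rewrite !mulr_natl derivMn.
rewrite derivM dexp derivD (derivM (_ * _) p) dnat.
rewrite (derivM (g ^+ k.+1)) (derivM (g ^+ k.+2)) !dexp natrM.
rewrite (exprS g k.+1) (exprS g k); ring.
Qed.

(** At a point of the line, [a] and [a1] stand for 1 + |x|^2 and its first derivative, [2 * w] for
    its second derivative with [w] = |v|^2, and [p], [p1], [p2] for f and its first two
    derivatives. *)
Lemma second_derivative_lower_bound (R : realFieldType) (N : nat)
    (K m w a a1 p p1 p2 : R) :
  (2 <= N)%N -> 3 * K + 1 <= 2 * N%:R -> 0 <= K -> 0 < m -> 0 <= w -> 1 <= a ->
  m <= p ->
  a * p1 ^+ 2 <= K * w * p ^+ 2 -> a * `|p2| <= K * w * p ->
  m * w <= a ^+ (N - 2) * ((N * N.-1)%:R * a1 ^+ 2 * p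
    + N%:R * a * (2 * w) * p + 2 * N%:R * a * a1 * p1 + a ^+ 2 * p2).
Proof.
move=> N2 NK K0 m0 w0 a1' mp h1 h2.
have p0 : 0 < p by exact: lt_le_trans mp.
set E := (X in _ <= _ * X).
(* The power of [a] is at least 1 and can only enlarge [E], which is nonnegative once it is at least
   [m * w]. *)
suff HE : m * w <= E.
  apply: (le_trans HE); rewrite ler_peMl ?exprn_ege1 //.
  by rewrite (le_trans _ HE) // mulr_ge0 // ltW.
have a0 : 0 <= a by lra.
have p0' : 0 <= p by exact: ltW.
have hp2 : - (K * w * p) <= a * p2.
  rewrite -[a * p2]opprK lerN2 -mulrN (le_trans _ h2) // ler_wpM2l //.
  by rewrite -normrN ler_norm.
(* After multiplication by [p], the terms in [a1] form a quadratic form in [a1 * p] and [a * p1]. *)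
suff : m * w * p <= E * p by rewrite ler_pM2r.
pose d : R := N.-1%:R.
have d1 : 1 <= d by rewrite ler1n; case: (N) N2 => [|[]].
have Nd : N%:R = d + 1 by rewrite /d natr1; congr (_%:R); case: (N) N2.
rewrite /E natrM -/d Nd.
have hsq : 0 <= (d + 1) / d * (d * a1 * p + a * p1) ^+ 2.
  by rewrite mulr_ge0 ?sqr_ge0 // divr_ge0; lra.
have hd : (d + 1) / d <= 2 by rewrite ler_pdivrMr; lra.
(* Completing the square absorbs the cross term [a a1 p1]. *)
have eq1 : (d + 1) * d * a1 ^+ 2 * p * p + 2 * (d + 1) * a * a1 * p1 * p =
    (d + 1) / d * (d * a1 * p + a * p1) ^+ 2
    - (d + 1) / d * (a * (a * p1 ^+ 2)).
  field; lra.
have h3 : (d + 1) / d * (a * (a * p1 ^+ 2)) <= 2 * (a * (K * w * p ^+ 2)).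
  apply: ler_pM => //; first by rewrite divr_ge0; lra.
    by rewrite mulr_ge0 // mulr_ge0 // sqr_ge0.
  by rewrite ler_wpM2l; lra.
have h4 : - (a * p * (K * w * p)) <= a * p * (a * p2).
  by rewrite -mulrN ler_wpM2l // mulr_ge0; lra.
have h5 : m * w * p <= a * w * p * p.
  rewrite ler_pM2r // mulrAC ler_wpM2r // (le_trans mp) // ler_peMl //; lra.
(* Completing the square costs at most [2 * K] copies of [a * w * p ^+ 2], and the [p2] term at most
   [K]. Out of the [2 * N] copies available at least one remains, and [h5] places it above
   [m * w * p]. *)
have h6 : 0 <= (2 * (d + 1) - 3 * K - 1) * (a * w * p * p).
  by rewrite !mulr_ge0 //; lra.
lra.
Qed.

(** * Growth of polynomials and the leading form *)

(** For coordinates bounded by [r >= 1], a monomial is at most [r] to its degree, so the sum of the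
    absolute values of the coefficients serves as [C]. The number [e] counts lost degrees; adding it
    on the left avoids truncated subtraction, and for [d < e] the hypothesis forces [f] to be
    zero. *)
Lemma peval_growth (R : realType) (n : nat) (f : mpoly.mpoly n R) (e d : nat) :
  (forall m, m \in mpoly.msupp f -> (mpoly.mdeg m + e <= d)%N) ->
  exists C : R, 0 <= C /\ forall (x : 'rV[R]_n) (r : R), 1 <= r ->
    (forall i, `|x ord0 i| <= r) -> r ^+ e * `|peval f x| <= C * r ^+ d.
Proof.
move=> fed; exists (\sum_(m <- mpoly.msupp f) `|mpoly.mcoeff m f|).
split; first exact: sumr_ge0.
move=> x r r1 xr; have r0 : 0 <= r := le_trans ler01 r1.
rewrite /peval mpoly.mevalE mulr_suml.
rewrite (le_trans (ler_wpM2l (exprn_ge0 _ r0) (ler_norm_sum _ _ _))) //.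
rewrite mulr_sumr big_seq [leRHS]big_seq; apply: ler_sum => m mf.
rewrite normrM mulrCA ler_wpM2l // normr_prod.
apply: (@le_trans _ _ (r ^+ e * \prod_(i < n) r ^+ m i)).
  rewrite ler_wpM2l ?exprn_ge0 //; apply: ler_prod => i _.
  by rewrite normr_ge0 normrX lerXn2r ?nnegrE.
by rewrite prodrXr -exprD addnC -mpoly.mdegE ler_weXn2l ?fed.
Qed.

Lemma msupp_mderiv (R : realType) (n : nat) (f : mpoly.mpoly n R) i m :
  m \in mpoly.msupp (mpoly.mderiv i f) ->
  mpoly.mnm_add m (mpoly.mnm1 i) \in mpoly.msupp f.
Proof.
rewrite !mpoly.mcoeff_msupp mpoly.mcoeff_mderiv.
by apply: contra_neq => ->; rewrite mul0rn.
Qed.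

Lemma mdeg_mderiv (R : realType) (n : nat) (f : mpoly.mpoly n R) i e d :
  (forall m, m \in mpoly.msupp f -> (mpoly.mdeg m + e <= d)%N) ->
  forall m, m \in mpoly.msupp (mpoly.mderiv i f) ->
    (mpoly.mdeg m + e.+1 <= d)%N.
Proof.
move=> fed m /msupp_mderiv/fed.
by rewrite mpoly.mdegD mpoly.mdeg1 -addnA add1n.
Qed.

Lemma mcoeff_leading_form (R : realType) (n : nat) (f : mpoly.mpoly n R) d m :
  mpoly.mcoeff m (leading_form f d) =
  if mpoly.mdeg m == d then mpoly.mcoeff m f else 0.
Proof.
rewrite /leading_form; case: eqP => [md|/eqP md]; last first.
  exact: mpoly.dhomog_nemf_coeff (mpoly.pihomogP _ d f) md.
rewrite mpoly.pihomogE [in RHS](mpoly.mpolyE f) !raddf_sum big_mkcond /=.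
apply: eq_bigr => k _; rewrite mpoly.mcoeffZ mpoly.mcoeffX.
have [->|km] := eqVneq k m; first by rewrite md eqxx.
by rewrite mulr0 if_same.
Qed.

Lemma mdeg_lower_part (R : realType) (n : nat) (f : mpoly.mpoly n R) d m :
  has_degree f d -> m \in mpoly.msupp (f - leading_form f d) ->
  (mpoly.mdeg m + 1 <= d)%N.
Proof.
move=> fd mh; rewrite addn1 ltn_neqAle.
move: mh; rewrite mpoly.mcoeff_msupp mpoly.mcoeffB mcoeff_leading_form.
case: (mpoly.mdeg m =P d) => [_|md]; first by rewrite subrr eqxx.
rewrite subr0 -mpoly.mcoeff_msupp => mf.
rewrite /= -ltnS -fd; exact: mpoly.msize_mdeg_lt.
Qed.

Lemma leading_form_scale (R : realType) (n : nat) (f : mpoly.mpoly n R) d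
    (c : R) (x : 'rV[R]_n) :
  peval (leading_form f d) (c *: x) = c ^+ d * peval (leading_form f d) x.
Proof.
rewrite /peval !mpoly.mevalE mulr_sumr big_seq [RHS]big_seq.
apply: eq_bigr => m mf.
rewrite mulrCA; congr (_ * _).
have md : mpoly.mdeg m = d.
  exact: (mpoly.dhomogP _ _ _ (mpoly.pihomogP _ d f) m mf).
rewrite -[in c ^+ d]md mpoly.mdegE -prodrXr.
by rewrite -big_split; apply: eq_bigr => i _; rewrite mxE exprMn.
Qed.

(** * Lower bounds from compactness of the unit sphere *)

Lemma peval_continuous (R : realType) (n : nat) (f : mpoly.mpoly n R) :
  continuous (peval f).
Proof.
have -> : peval f = fun x : 'rV[R]_n => \sum_(m <- mpoly.msupp f)
    mpoly.mcoeff m f * \prod_i x ord0 i ^+ m i.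
  by apply/funext => x; rewrite /peval mpoly.mevalE.
apply: continuous_big => [|m _ x]; first exact: add_continuous.
have pc : continuous (fun y : 'rV[R]_n => \prod_(i < n) y ord0 i ^+ m i : R).
  apply: continuous_big => [|i _]; first exact: mul_continuous.
  move=> y; apply: (continuous_comp (g := fun t : R => t ^+ m i)).
    exact: coord_continuous.
  exact: exprn_continuous.
apply: (@continuousM R _ (fun=> mpoly.mcoeff m f) _ x _ (pc x)).
exact: cst_continuous.
Qed.

(** The sphere of the sup norm is compact, so [|h|] attains its minimum there, and this minimum is
    not 0. The dimension [n.+1] makes the sphere nonempty. *)
Lemma sphere_lower_bound (R : realType) (n : nat) (h : 'rV[R]_n.+1 -> R) :
  continuous h -> (forall x, h x = 0 -> x = 0) ->
  exists2 c, 0 < c & forall x, `|x| = 1 -> c <= `|h x|.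
Proof.
move=> hc h0.
pose S : set 'rV[R]_n.+1 := [set x | `|x| = 1].
have Sc : closed S.
  have := continuous_closedP (fun x : 'rV[R]_n.+1 => `|x|).
  by move=> [+ _] => /(_ norm_continuous)/(_ [set 1]); apply; exact: closed_eq.
have : compact S.
  apply: bounded_closed_compact => //; exists 1; split => // M M1 x /= ->.
  exact: ltW.
have S0 : S !=set0.
  pose u : 'rV[R]_n.+1 := const_mx 1.
  have u0 : u != 0.
    by apply/eqP => /matrixP/(_ ord0 ord0)/eqP; rewrite !mxE oner_eq0.
  by exists (`|u|^-1 *: u); rewrite /S /= normfZV.
have hcn : {within S, continuous (fun x => `|h x|)}.
  apply: continuous_subspaceT => x; apply: continuous_comp; first exact: hc.
  exact: norm_continuous.
move=> /(EVT_min_rV S0) /(_ hcn)[c cS cmin].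
exists `|h c|; last by move=> x /= xS; apply: cmin; rewrite inE.
rewrite normr_gt0; apply/eqP => /h0 c0; move: cS.
by rewrite inE /S /= c0 normr0 => /eqP; rewrite eq_sym oner_eq0.
Qed.

Lemma coord_le_mx_norm (R : realType) (n : nat) (x : 'rV[R]_n) i :
  `|x ord0 i| <= `|x|.
Proof.
rewrite [leRHS]/Num.norm /= mx_normrE; apply/bigmax_geP; right => /=.
by exists (ord0, i).
Qed.

Lemma coord_le_sqrt_sqnorm (R : realType) (n : nat) (x : 'rV[R]_n) i :
  `|x ord0 i| <= Num.sqrt (sqnorm x).
Proof.
rewrite -sqrtr_sqr ler_wsqrtr // /sqnorm (bigD1 i) //= lerDl.
by apply: sumr_ge0 => j _; exact: sqr_ge0.
Qed.

Lemma sqnorm_ge0 (R : realType) (n : nat) (x : 'rV[R]_n) : 0 <= sqnorm x.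
Proof. by apply: sumr_ge0 => i _; exact: sqr_ge0. Qed.

Lemma sqnorm_le_mx_norm (R : realType) (n : nat) (x : 'rV[R]_n) :
  sqnorm x <= n%:R * `|x| ^+ 2.
Proof.
rewrite /sqnorm -[n in n%:R]card_ord mulr_natl -sumr_const.
apply: ler_sum => i _; rewrite -[leLHS]real_normK ?num_real //.
by rewrite lerXn2r ?nnegrE // coord_le_mx_norm.
Qed.

(** A form of degree 0 takes the same value at the all-ones vector as at 0, by scaling with the
    factor 0 and [0 ^+ 0 = 1]; it would thus vanish away from the origin. *)
Lemma degree_gt0 (R : realType) (n : nat) (f : mpoly.mpoly n.+1 R) d :
  (forall x : 'rV[R]_n.+1, peval (leading_form f d) x = 0 <-> x = 0) ->
  (0 < d)%N.
Proof.
move=> fd0; rewrite lt0n; apply/eqP => d0; rewrite {}d0 in fd0.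
have /fd0/matrixP/(_ ord0 ord0) : peval (leading_form f 0)
    (const_mx 1 : 'rV[R]_n.+1) = 0.
  have := leading_form_scale f 0 0 (const_mx 1 : 'rV[R]_n.+1).
  by rewrite expr0 mul1r scale0r (fd0 0).2.
by rewrite !mxE => /eqP; rewrite oner_eq0.
Qed.

Lemma peval_lower_growth (R : realType) (n : nat) (X : set 'rV[R]_n.+1)
    (f : mpoly.mpoly n.+1 R) (d : nat) (m : R) :
  has_degree f d ->
  (forall x : 'rV[R]_n.+1, peval (leading_form f d) x = 0 -> x = 0) ->
  0 < m -> (forall x, X x -> m <= peval f x) ->
  exists2 c : R, 0 < c &
    forall x, X x -> c * Num.max 1 `|x| ^+ d <= peval f x.
Proof.
move=> fd fd0 m0 mf.
have [e e0 eP] := sphere_lower_bound (@peval_continuous _ _ _) fd0.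
have [C [C0 CP]] := peval_growth (fun m => @mdeg_lower_part _ _ f d m fd).
(* Beyond [r0] the lower part, at most [C * r ^+ d / r], is at most half of the bound [e * r ^+ d]
   for the leading form. The summand 1 ensures [r = |x|] there. *)
pose r0 := 1 + 2 * C / e.
have r01 : 1 <= r0 by rewrite lerDl divr_ge0 ?mulr_ge0 // ltW.
have r0d : 0 < r0 ^+ d by rewrite exprn_gt0 // (lt_le_trans ltr01).
(* The first constant serves the points with [|x| <= r0], where only [f >= m] is used; the second
   serves the others. *)
exists (Num.min (m / r0 ^+ d) (e / 2)).
  by rewrite lt_min !divr_gt0.
move=> x Xx; set r := Num.max 1 `|x|.
have r1 : 1 <= r by rewrite le_max lexx.
have r_gt0 : 0 < r := lt_le_trans ltr01 r1.
have rd : 0 <= r ^+ d by rewrite exprn_ge0 // ltW.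
have [xr|xr] := leP `|x| r0.
  apply: le_trans (mf x Xx).
  rewrite (@le_trans _ _ (m / r0 ^+ d * r ^+ d)) //.
    by rewrite ler_wpM2r // ge_min lexx.
  rewrite mulrAC ler_pdivrMr // ler_pM2l // lerXn2r ?nnegrE //.
  - exact: ltW.
  - exact: le_trans ler01 r01.
  - by rewrite ge_max r01.
rewrite (@le_trans _ _ (e / 2 * r ^+ d)) //.
  by rewrite ler_wpM2r // ge_min lexx orbT.
have rx : r = `|x| by apply/max_idPr; rewrite ltW // (le_lt_trans r01).
have lead : e * r ^+ d <= `|peval (leading_form f d) x|.
  (* Homogeneity reduces the bound to the point [r^-1 *: x] of the unit sphere. *)
  have x0 : x != 0 by rewrite -normr_gt0 -rx.
  rewrite -[x in peval _ x](scalerKV (a := r)) ?gt_eqF // leading_form_scale.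
  rewrite normrM ger0_norm // mulrC ler_wpM2l // eP //.
  by rewrite rx normfZV.
have low : `|peval (f - leading_form f d) x| <= e / 2 * r ^+ d.
  rewrite -(ler_pM2l r_gt0).
  have := CP x r r1; rewrite expr1 => /(_ _)/le_trans; apply.
    by move=> i; rewrite rx coord_le_mx_norm.
  rewrite mulrA ler_wpM2r //.
  have : 2 * C / e <= r by rewrite rx ltW // (le_lt_trans _ xr) // lerDr.
  rewrite ler_pdivrMr //; lra.
have -> : peval f x = `|peval f x|.
  by rewrite ger0_norm // (le_trans (ltW m0)) // mf.
have -> : peval f x =
    peval (leading_form f d) x + peval (f - leading_form f d) x.
  by rewrite /peval mpoly.mevalB addrC subrK.
set a := peval (leading_form f d) x in lead *.
set b := peval (f - leading_form f d) x in low *.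
have := lerB_normD a b; lra.
Qed.

(** * Directional derivatives bounded by the polynomial itself *)

Lemma weighted_sum_le (R : realDomainType) (n : nat) (u v C : 'I_n -> R)
    (r s t : R) : 0 <= r ->
  (forall i, `|u i| <= s) -> (forall i, r * `|v i| <= C i * t) ->
  r * `|\sum_i u i * v i| <= s * (\sum_i C i) * t.
Proof.
move=> r0 us vC.
rewrite (le_trans (ler_wpM2l r0 (ler_norm_sum _ _ _))) // -mulrA !mulr_suml.
rewrite !mulr_sumr; apply: ler_sum => i _; rewrite normrM mulrCA.
by apply: ler_pM; rewrite ?mulr_ge0.
Qed.

(** Each derivative lowers the degree by one, which pays for one factor [r = max 1 |x|]; what
    remains is a multiple of [r ^+ d], and that is at most [peval f x / c]. The weight 1 + |x|^2
    costs two factors [r]: one for each [p1] in the square, or both for [p2]. *)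
Lemma peval_derivatives_bound (R : realType) (n : nat) (X : set 'rV[R]_n.+1)
    (f : mpoly.mpoly n.+1 R) (d : nat) (m : R) :
  has_degree f d ->
  (forall x : 'rV[R]_n.+1, peval (leading_form f d) x = 0 <-> x = 0) ->
  0 < m -> (forall x, X x -> m <= peval f x) ->
  exists2 K : R, 0 <= K & forall (x v : 'rV[R]_n.+1), X x ->
    let p1 := \sum_i v ord0 i * peval (mpoly.mderiv i f) x in
    let p2 := \sum_i v ord0 i * \sum_j v ord0 j *
      peval (mpoly.mderiv j (mpoly.mderiv i f)) x in
    (1 + sqnorm x) * p1 ^+ 2 <= K * sqnorm v * peval f x ^+ 2 /\
    (1 + sqnorm x) * `|p2| <= K * sqnorm v * peval f x.
Proof.
move=> fd fd0 m0 mf.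
have d0 := degree_gt0 fd0.
have [c c0 cP] := peval_lower_growth fd (fun x => (fd0 x).1) m0 mf.
have deg0 k : k \in mpoly.msupp f -> (mpoly.mdeg k + 0 <= d)%N.
  by move=> kf; rewrite addn0 -ltnS -fd; exact: mpoly.msize_mdeg_lt.
have deg1 i := @mdeg_mderiv _ _ _ i _ _ deg0.
have deg2 i j : forall k,
    k \in mpoly.msupp (mpoly.mderiv j (mpoly.mderiv i f)) ->
    (mpoly.mdeg k + 2 <= d)%N.
  by apply: mdeg_mderiv; exact: deg1.
have [C1 C1P] := choice (fun i => peval_growth (deg1 i)).
have [C2 C2P] := choice (fun ij => peval_growth (deg2 ij.1 ij.2)).
pose B1 := \sum_i C1 i; pose B2 := \sum_i \sum_j C2 (i, j).
have B20 : 0 <= B2.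
  by apply: sumr_ge0 => i _; apply: sumr_ge0 => j _; case: (C2P (i, j)).
have n0 : 0 <= n.+2%:R :> R by exact: ler0n.
(* The dimension is [n.+1] and [r] is a sup norm, so |x|^2 is at most [n.+1%:R * r ^+ 2]; the
   summand 1 of the weight raises this to [n.+2]. *)
pose K1 := n.+2%:R * B1 ^+ 2 / c ^+ 2; pose K2 := n.+2%:R * B2 / c.
have K10 : 0 <= K1 by rewrite divr_ge0 ?sqr_ge0 // mulr_ge0 ?sqr_ge0.
have K20 : 0 <= K2 by rewrite divr_ge0 ?mulr_ge0 // ltW.
exists (K1 + K2) => [|x v Xx p1 p2]; first exact: addr_ge0.
have w0 := sqnorm_ge0 v.
have fx0 : 0 <= peval f x by rewrite (le_trans (ltW m0)) // mf.
set r := Num.max 1 `|x|.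
have r1 : 1 <= r by rewrite le_max lexx.
have r0 : 0 <= r := le_trans ler01 r1.
have xr i : `|x ord0 i| <= r.
  by rewrite (le_trans (coord_le_mx_norm x i)) // le_max lexx orbT.
have ar : 1 + sqnorm x <= n.+2%:R * r ^+ 2.
  rewrite -natr1 mulrDl mul1r addrC lerD //; last by rewrite expr_ge1.
  rewrite (le_trans (sqnorm_le_mx_norm x)) // ler_wpM2l //.
  by rewrite lerXn2r ?nnegrE // le_max lexx orbT.
have rdf : r ^+ d <= peval f x / c by rewrite ler_pdivlMr // mulrC cP.
have rd0 : 0 <= r ^+ d by exact: exprn_ge0.
set s := Num.sqrt (sqnorm v).
have s0 : 0 <= s by exact: sqrtr_ge0.
have sw : s ^+ 2 = sqnorm v by rewrite sqr_sqrtr.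
have p1r : r * `|p1| <= s * B1 * r ^+ d.
  apply: weighted_sum_le => // i; first exact: coord_le_sqrt_sqnorm.
  by have := (C1P i).2 x r r1 xr; rewrite expr1.
(* The weighted sum estimate is iterated: the outer sum takes [t := s * r ^+ d] and the inner one
   [t := r ^+ d], so each sum contributes one factor [s] = |v|. *)
have p2r : r ^+ 2 * `|p2| <= s * B2 * (s * r ^+ d).
  apply: weighted_sum_le => [|i|i]; first exact: exprn_ge0.
    exact: coord_le_sqrt_sqnorm.
  rewrite mulrA [_ * s]mulrC.
  apply: weighted_sum_le => [|j|j]; first exact: exprn_ge0.
    exact: coord_le_sqrt_sqnorm.
  exact: (C2P (i, j)).2.
split.
  rewrite (@le_trans _ _ (K1 * sqnorm v * peval f x ^+ 2)) //; last first.
    by rewrite ler_wpM2r ?sqr_ge0 // ler_wpM2r // lerDl.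
  rewrite (@le_trans _ _ (n.+2%:R * (r * `|p1|) ^+ 2)) //.
    by rewrite exprMn real_normK ?num_real // [leRHS]mulrA ler_wpM2r ?sqr_ge0.
  rewrite (@le_trans _ _ (n.+2%:R * (s * B1 * (peval f x / c)) ^+ 2)) //.
    have B10 : 0 <= B1 by apply: sumr_ge0 => i _; case: (C1P i).
    rewrite ler_wpM2l // lerXn2r ?nnegrE ?(le_trans p1r) //.
    - by rewrite mulr_ge0.
    - by rewrite !mulr_ge0 // invr_ge0 ltW.
    - by rewrite ler_wpM2l // mulr_ge0.
  rewrite -sw /K1 le_eqVlt; apply/orP; left; apply/eqP.
  by field; exact: lt0r_neq0.
rewrite (@le_trans _ _ (K2 * sqnorm v * peval f x)) //; last first.
  by rewrite ler_wpM2r // ler_wpM2r // lerDr.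
rewrite (@le_trans _ _ (n.+2%:R * (r ^+ 2 * `|p2|))) //.
  by rewrite mulrA ler_wpM2r.
rewrite (@le_trans _ _ (n.+2%:R * (s * B2 * (s * (peval f x / c))))) //.
  rewrite ler_wpM2l // (le_trans p2r) //.
  by rewrite !ler_wpM2l // mulr_ge0.
rewrite -sw /K2 le_eqVlt; apply/orP; left; apply/eqP; ring.
Qed.

(** * The factor 1 + |x|^2 on a line *)

Section RegularizerOnLine.
Context {R : realType} {n : nat}.
Implicit Types (x v : 'rV[R]_n).

Let g : mpoly.mpoly n R := 1 + \sum_(i < n) mpoly.mpolyX R (mpoly.mnm1 i) ^+ 2.

Lemma line_poly_one_add_sqnormE x v :
  line_poly x v g = 1 + \sum_i line_coord x v i ^+ 2.
Proof.
rewrite /line_poly rmorphD rmorph1 rmorph_sum; congr (_ + _).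
by apply: eq_bigr => i _; rewrite rmorphXn /= -/(line_poly _ _ _) line_polyX.
Qed.

Lemma horner_line_one_add_sqnorm x v t :
  (line_poly x v g).[t] = 1 + sqnorm (x + t *: v).
Proof.
rewrite line_poly_one_add_sqnormE hornerD hornerC horner_sum; congr (_ + _).
by apply: eq_bigr => i _; rewrite horner_exp horner_line_coord.
Qed.

Lemma deriv2_line_one_add_sqnorm x v :
  (line_poly x v g)^`()^`() = (2 * sqnorm v)%:P.
Proof.
rewrite line_poly_one_add_sqnormE derivD derivC add0r !raddf_sum.
rewrite /sqnorm mulr_sumr rmorph_sum; apply: eq_bigr => i _ /=.
rewrite deriv_exp /= expr1 derivMn derivM !deriv_line_coord derivC.
by rewrite mul0r add0r -polyCM -polyCMn mulr_natl.
Qed.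

End RegularizerOnLine.

(** * From lines to strong convexity *)

Lemma convex_function_along_lines (R : realType) (n : nat) (X : set 'rV[R]_n)
    (F : 'rV[R]_n -> R) (h : 'rV[R]_n -> 'rV[R]_n -> {poly R}) :
  convex_set (M := 'rV[R]_n) X ->
  (forall x v t, (h x v).[t] = F (x + t *: v)) ->
  (forall x v t, X (x + t *: v) -> 0 <= (h x v)^`()^`().[t]) ->
  convex_function (E := 'rV[R]_n) X F.
Proof.
move=> Xc hF h2 t x y xX yX.
(* In [conv s x y] the weight [s] belongs to [x], so the line starts at [y] and has direction
   [x - y]. Convexity of [X] keeps the parameters in [[0, 1]] inside [X], where the second
   derivative is controlled. *)
have segment (s : {i01 R}) : conv s x y = y + s%:num *: (x - y).
  rewrite [LHS](_ : _ = s%:num *: x + (1 - s%:num) *: y) //.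
  by rewrite scalerBl scale1r scalerBr addrCA.
have h0 : (h y (x - y)).[0] = F y by rewrite hF scale0r addr0.
have h1 : (h y (x - y)).[1] = F x by rewrite hF scale1r subrKC.
rewrite segment -hF convRE -h0 -h1.
apply: horner_convex => [s /andP[s0 s1]|]; last by rewrite ge0 le1.
apply: h2; have := Xc x y (Itv01 s0 s1) xX yX.
by rewrite segment /= inE.
Qed.

Lemma phi_poly_strongly_convex (R : realType) (n : nat) (X : set 'rV[R]_n)
    (f : mpoly.mpoly n R) (K m : R) (N : nat) :
  convex_set (M := 'rV[R]_n) X -> 0 < m -> 0 <= K ->
  (forall x, X x -> m <= peval f x) ->
  (forall (x v : 'rV[R]_n), X x ->
    let p1 := \sum_i v ord0 i * peval (mpoly.mderiv i f) x in
    let p2 := \sum_i v ord0 i * \sum_j v ord0 j *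
      peval (mpoly.mderiv j (mpoly.mderiv i f)) x in
    (1 + sqnorm x) * p1 ^+ 2 <= K * sqnorm v * peval f x ^+ 2 /\
    (1 + sqnorm x) * `|p2| <= K * sqnorm v * peval f x) ->
  (2 <= N)%N -> 3 * K + 1 <= 2 * N%:R ->
  strongly_convex X (peval (phi_poly f N)).
Proof.
move=> Xc m0 K0 mf bound N2 NK; exists m; split => //.
pose g : mpoly.mpoly n R :=
  1 + \sum_(i < n) mpoly.mpolyX R (mpoly.mnm1 i) ^+ 2.
(* Subtracting 1 from the restriction of [g] leaves the squared norm along the line. With modulus
   [m], the subtracted term has second derivative [m * sqnorm v], exactly the lower bound available
   for the first term. *)
pose h x v := line_poly x v (phi_poly f N) - (m / 2) *: (line_poly x v g - 1).
apply: (convex_function_along_lines (h := h)) => // x v t.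
  rewrite /h hornerD hornerN hornerZ hornerD hornerN hornerC.
  by rewrite horner_line_one_add_sqnorm horner_line_poly addrAC subrr add0r.
set z := x + t *: v => Xz.
have [b1 b2] := bound z v Xz.
rewrite /h /phi_poly line_polyM -/g.
have -> : line_poly x v (g ^+ N) = line_poly x v g ^+ N.
  by rewrite /line_poly rmorphXn.
rewrite !derivB !derivZ !derivB !derivC subr0.
have NE : N = (N - 2).+2 by rewrite -addn2 subnK.
rewrite [in line_poly x v g ^+ N]NE deriv2_expM deriv2_line_one_add_sqnorm.
rewrite !(horner_exp, hornerD, hornerM, hornerN, hornerZ, hornerC).
rewrite (horner_deriv_line_poly x v f) horner_deriv2_line_poly.
rewrite horner_line_one_add_sqnorm horner_line_poly -/z.
rewrite [m / 2 * _]mulrA divfK ?pnatr_eq0 // subr_ge0.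
rewrite -NE (_ : (N - 2).+1 = N.-1); last by rewrite [in RHS]NE.
have a1 : 1 <= 1 + sqnorm z by rewrite lerDl sqnorm_ge0.
exact: (second_derivative_lower_bound (line_poly x v g)^`().[t]
  N2 NK K0 m0 (sqnorm_ge0 v) a1 (mf z Xz) b1 b2).
Qed.

Theorem theorem5p5 (R : realType) (n : nat) (X : set 'rV[R]_n)
    (X_convex : convex_set (M := 'rV[R]_n) X) (X_closed : closed X)
    (f : mpoly.mpoly n R) (d : nat) (f_degree : has_degree f d)
    (f_pos : forall x : 'rV[R]_n, X x -> 0 < peval f x)
    (fd_zero : [set x : 'rV[R]_n | peval (leading_form f d) x = 0]
               = [set 0])
    (f_inf : exists m : R, 0 < m /\
       (m%:E <= ereal_inf [set (peval f x)%:E | x in X])%E) :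
  exists N0 : nat, forall N : nat, (N0 <= N)%N ->
    strongly_convex X (peval (phi_poly f N)).
Proof.
case: n => [|n] in X X_convex X_closed f f_degree f_pos fd_zero f_inf *.
  (* In dimension 0 the space is a single point, so every function is convex and any positive
     modulus works. *)
  exists 0 => N _; exists 1; split => // t x y _ _.
  by rewrite (thinmx0 x) (thinmx0 y) !convmm.
have [m [m0 mX]] := f_inf.
have mf x : X x -> m <= peval f x.
  move=> Xx; rewrite -lee_fin (le_trans mX) //.
  by apply: ereal_inf_lbound; exists x.
have fd0 (x : 'rV[R]_n.+1) : peval (leading_form f d) x = 0 <-> x = 0.
  have -> : (peval (leading_form f d) x = 0) =
    [set x | peval (leading_form f d) x = 0] x by [].
  by rewrite fd_zero.
have [K K0 bound] := peval_derivatives_bound f_degree fd0 m0 mf.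
(* The bound 2 makes the exponent [N - 2] genuine. The Archimedean bound gives [3 * K + 1 <= N],
   hence also [<= 2 * N]. *)
exists (maxn 2 (Num.bound (3 * K + 1))) => N; rewrite geq_max => /andP[N2 NK].
apply: (phi_poly_strongly_convex X_convex m0 K0 mf bound N2).
have : 3 * K + 1 <= N%:R.
  rewrite ltW // (lt_le_trans (archi_boundP _)) ?ler_nat //; lra.
have : 0 <= N%:R :> R by exact: ler0n.
lra.
Qed.
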